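(* Let $n\ge 1$. Any adaptive algorithm that solves Maximal Sub-repository on all repositories with $n$ packages that have no conflicts ($C=\emptyset$), at most one unknown dependency ($|U|\le 1$) and at most one root defect (with no bound on the total number of defects) must make at least $n$ queries (i.e., there is such a repository on which it makes at least $n$ queries).
   Context: A repository consists of a finite set $P$ of $n$ packages, a set $K\subseteq P\times P$ of known dependencies, a set $U\subseteq P\times P$ of unknown dependencies, a set $C$ of unknown conflicts (unordered pairs of distinct packages), and a set $D\subseteq P$ of defects. A dependency $(q,p)\in K\cup U$ means that $q$ depends on $p$. The digraph $(P,K)$ is acyclic. An installation is a subset $I\subseteq P$; it is successful iff (i) $I\cap D=\emptyset$, (ii) for every $(q,p)\in K\cup U$, $q\in I$ implies $p\in I$, and (iii) no $\{p,q\}\in C$ satisfies $p,q\in I$. A defect is a package contained in no successful installation, and $D$ is the set of all defects (so every package outside $D$ lies in some successful installation; in particular a package that depends on a defect is a defect). A root defect is a defect $p$ such that no package that $p$ depends on is a defect. An algorithm is given $P$, $K$ and the stated bounds. A query is an installation $I\subseteq P$; the oracle answers whether $I$ is successful. An adaptive algorithm asks one query at a time and may choose each query depending on the previous answers. Local computation is free; the cost is the number of queries. Maximal Sub-repository: find a maximum-size set of packages $P_{max}\subseteq P$ that is a successful installation (possibly empty). *)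

(* Defs.v *)
From mathcomp Require Import all_boot.

Set Implicit Arguments.
Unset Strict Implicit.
Unset Printing Implicit Defensive.

(* A pair (q, p) in a set of dependencies means that q depends on p. *)
Definition acyclic (P : finType) (K : {set P * P}) : Prop :=
  forall c : seq P, cycle [rel q p | (q, p) \in K] c -> c = [::].

Record repo_data (P : finType) := RepoData {
  known : {set P * P};
  unknown : {set P * P};
  conflicts : {set {set P}};
  defects : {set P}
}.

Section RepoData.
Variables (P : finType) (r : repo_data P).

Definition depends (q p : P) : bool := (q, p) \in known r :|: unknown r.

Definition successful (I : {set P}) : bool :=
  [&& [disjoint I & defects r],
      [forall q, forall p, depends q p ==> (q \in I) ==> (p \in I)]
    & [forall c in conflicts r, ~~ (c \subset I)]].

Definition is_defect (p : P) : Prop :=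
  forall I : {set P}, successful I -> p \notin I.

Definition wf_repo : Prop :=
  [/\ acyclic (known r),
      forall c, c \in conflicts r -> #|c| = 2
    & forall p, p \in defects r <-> is_defect p].

Definition root_defects : {set P} :=
  [set p in defects r | [forall q, depends p q ==> (q \notin defects r)]].

Definition maximum_successful (X : {set P}) : Prop :=
  successful X /\ forall Y : {set P}, successful Y -> #|Y| <= #|X|.

End RepoData.

Record repository (P : finType) := Repository {
  repo_val :> repo_data P;
  repo_wf : wf_repo repo_val
}.

Inductive action (P : finType) :=
  | Query of {set P}
  | Output of {set P}.

(* Past queries with the oracle's answers, oldest first. *)
Definition history (P : finType) := seq ({set P} * bool).

(* The first argument is the set of known dependencies; the next action may
   depend arbitrarily on it and on all previous answers. *)
Definition algorithm (P : finType) := {set P * P} -> history P -> action P.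

(* exec s O h h' X: from history h, the strategy s run against the oracle O
   halts with full history h' and output X. Runs that never output have no
   derivation. *)
Inductive exec (P : finType) (s : history P -> action P) (O : {set P} -> bool) :
    history P -> history P -> {set P} -> Prop :=
  | ExecOutput h X : s h = Output X -> exec s O h h X
  | ExecQuery h I h' X : s h = Query I ->
      exec s O (rcons h (I, O I)) h' X -> exec s O h h' X.

Definition run (P : finType) (A : algorithm P) (r : repository P) :
    history P -> {set P} -> Prop :=
  exec (A (known r)) (successful r) [::].

Definition solves_maximal_subrepository (P : finType) (A : algorithm P)
    (class : repository P -> Prop) : Prop :=
  forall r, class r -> exists h X, run A r h X /\ maximum_successful r X.

(* The run is deterministic, so m is the number of queries made on r. *)
Definition makes_queries (P : finType) (A : algorithm P) (r : repository P)
    (m : nat) : Prop :=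
  exists h X, run A r h X /\ size h = m.

Definition no_conflict_one_unknown_one_root (P : finType) (r : repository P) :
    Prop :=
  [/\ conflicts r = set0, #|unknown r| <= 1 & #|root_defects r| <= 1].

(* Main.v *)
Require Import Defs.
From mathcomp Require Import all_boot.

Set Implicit Arguments.
Unset Strict Implicit.
Unset Printing Implicit Defensive.

(** Let the known dependencies form a linear order, so that only its initial
    segments can be successful. For k <= n, let every package beyond the first
    k be a defect and, if k > 0, let the first package depend, by the only
    unknown dependency, on the k-th one: then the successful installations are
    exactly the empty one and the initial segment of size k. On the repository
    with k = 0 every nonempty query fails. If the segment of size k > 0 is not
    queried there, then the run is the same on the repository with that k, and
    the algorithm wrongly outputs the empty installation. *)

Section Executions.
Variables (P : finType) (s : history P -> action P).

Lemma exec_sub O h h' X : exec s O h h' X -> {subset h <= h'}.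
Proof.
elim=> [{}h {}X _ x //|{}h I {}h' {}X _ _ IH x xh].
by apply: IH; rewrite mem_rcons inE xh orbT.
Qed.

(** A strategy sees its oracle only through the answers recorded in the final history. *)
Lemma eq_exec O O' h h' X :
    exec s O h h' X -> {in map fst h', O =1 O'} -> exec s O' h h' X.
Proof.
elim=> [{}h {}X sh _|{}h I {}h' {}X sh e IH eqO]; first exact: ExecOutput.
apply: (ExecQuery sh); rewrite -eqO; first exact: IH.
apply/mapP; exists (I, O I) => //.
by apply: (exec_sub e); rewrite mem_rcons mem_head.
Qed.

(** Solving only promises some correct run; determinism identifies it with a run built by hand. *)
Lemma exec_output_inj O h h1 h2 X1 X2 :
  exec s O h h1 X1 -> exec s O h h2 X2 -> X1 = X2.
Proof.
move=> e1; elim: e1 h2 X2 => [{}h X sh|{}h I h' X sh _ IH] h2 X2 e2.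
  by case: e2 sh => [h0 X0 -> [->]|h0 I h'' X0 ->].
by case: e2 sh IH => [h0 X0 ->|h0 I0 h'' X0 -> e [<-] IH] //; apply: IH e.
Qed.

End Executions.

Section HardRepositories.
Variable P : finType.

Definition rank (x : P) : nat := enum_rank x.

Lemma rank_inj : injective rank.
Proof. by move=> x y /val_inj/enum_rank_inj. Qed.

Lemma rank_surj k : k < #|P| -> exists x, rank x = k.
Proof.
by move=> ltk; exists (enum_val (Ordinal ltk)); rewrite /rank enum_valK.
Qed.

Definition segment k : {set P} := [set x | rank x < k].

Lemma segment0 : segment 0 = set0.
Proof. by apply/setP => x; rewrite !inE. Qed.

Lemma segmentS_neq0 k : k < #|P| -> segment k.+1 != set0.
Proof.
case: k => [|k] /rank_surj[x xk];
  by apply/set0Pn; exists x; rewrite inE xk.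
Qed.

Lemma segmentS_inj : {in gtn #|P| &, injective (fun k => segment k.+1)}.
Proof.
move=> j k /rank_surj[x xj] /rank_surj[y yk] /setP eqS.
have := eqS x; have := eqS y; rewrite !inE xj yk !ltnS !leqnn => kj jk.
by apply/eqP; rewrite eqn_leq kj -jk.
Qed.

Definition linear_order : {set P * P} := [set z | rank z.2 < rank z.1].

(** Ranks strictly decrease along a path, so a cycle would put a rank below itself. *)
Lemma linear_order_acyclic : acyclic linear_order.
Proof.
case=> // x c /=.
rewrite (eq_path (e' := fun q p => rank p < rank q)); last first.
  by move=> q p; rewrite /= inE.
move/order_path_min; have tr : transitive (fun q p => rank p < rank q).
  by move=> b a d ba db; apply: ltn_trans ba.
by move/(_ tr); rewrite all_rcons ltnn.
Qed.

(** Ranks start at 0, so the [k]-th package has rank [k - 1]. The successor form makes [unknown]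
    empty for [k = 0]; for [k = 1] it is a harmless self-loop. *)
Definition hard_data k : repo_data P :=
  {| known := linear_order;
     unknown := [set z | (rank z.1 == 0) && ((rank z.2).+1 == k)];
     conflicts := set0;
     defects := ~: segment k |}.

Lemma hard_dependsE k q p :
  depends (hard_data k) q p =
    (rank p < rank q) || (rank q == 0) && ((rank p).+1 == k).
Proof. by rewrite /depends !inE. Qed.

(** From any member, known dependencies lead down to the first package, the unknown one jumps to
    rank [k - 1], and known ones then fill the segment. *)
Lemma hard_successfulE k I : k <= #|P| ->
  successful (hard_data k) I = (I == set0) || (I == segment k).
Proof.
move=> lek; apply/idP/idP => [|/orP[]/eqP->].
- case/and3P; rewrite /= disjoints_subset setCK => /subsetP sub /forallP dep _.
  have {}dep q p : depends (hard_data k) q p -> q \in I -> p \in I.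
    by move=> qp qI; have /forallP/(_ p) := dep q; rewrite qp qI.
  have [//|/= /set0Pn[x xI]] := eqVneq I set0.
  rewrite eqEsubset; apply/andP; split; apply/subsetP => // y.
  have := sub _ xI; rewrite !inE.
  case: k lek sub dep => [//|k] lek sub dep _ yk.
  have [p0 p0E] := rank_surj (leq_ltn_trans (leq0n k) lek).
  have [pk pkE] := rank_surj lek.
  have p0I : p0 \in I.
    have [x0|x_gt0] := posnP (rank x).
      by rewrite (@rank_inj p0 x) // x0.
    by apply: dep xI; rewrite hard_dependsE p0E x_gt0.
  have pkI : pk \in I.
    by apply: dep p0I; rewrite hard_dependsE p0E pkE !eqxx orbT.
  move: yk; rewrite ltnS leq_eqVlt => /orP[/eqP yk|yk].
    by rewrite (@rank_inj y pk) // pkE.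
  by apply: dep pkI; rewrite hard_dependsE pkE yk.
- apply/and3P; split; first by rewrite disjoints_subset sub0set.
    by apply/forallP => q; apply/forallP => p; rewrite in_set0 implybT.
  by apply/forallP => c; rewrite in_set0.
- apply/and3P; split; first by rewrite disjoints_subset setCK.
    apply/forallP => q; apply/forallP => p; rewrite hard_dependsE !inE.
    apply/implyP => /orP[pq|/andP[_ /eqP<-]]; apply/implyP => // qk.
    exact: ltn_trans qk.
  by apply/forallP => c; rewrite in_set0.
Qed.

Lemma hard_wf k : k <= #|P| -> wf_repo (hard_data k).
Proof.
move=> lek; split; first exact: linear_order_acyclic.
  by move=> c; rewrite in_set0.
move=> p; rewrite inE; split=> [pk I|].
  by rewrite hard_successfulE // => /orP[]/eqP-> //; rewrite in_set0.
by apply; rewrite hard_successfulE // eqxx orbT.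
Qed.

Definition hard_repo k (lek : k <= #|P|) := Repository (hard_wf lek).

Lemma hard_class k (lek : k <= #|P|) :
  no_conflict_one_unknown_one_root (hard_repo lek).
Proof.
split=> //; apply/card_le1_eqP.
  case=> [a b] [c d]; rewrite !inE /=.
  move=> /andP[/eqP a0 /eqP bk] /andP[/eqP c0 /eqP dk].
  congr (_, _); apply: rank_inj; first by rewrite a0.
  by apply: succn_inj; rewrite bk.
(* A defect of rank above [k] depends on the package of rank [k], itself a defect. *)
have root_rank x : x \in root_defects (hard_repo lek) -> rank x = k.
  rewrite !inE -leqNgt => /andP[kx /forallP root].
  apply/eqP; rewrite eqn_leq kx andbT leqNgt; apply/negP => ltkx.
  have [y yk] := rank_surj (ltn_trans ltkx (ltn_ord (enum_rank x))).
  by have := root y; rewrite hard_dependsE !inE yk ltkx ltnn.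
by move=> x y /root_rank xk /root_rank yk; apply: rank_inj; rewrite xk.
Qed.

End HardRepositories.

Theorem theorem3 (n : nat) (n_ge1 : 1 <= n)
    (P : finType) (card_P : #|P| = n) (A : algorithm P)
    (A_solves :
      solves_maximal_subrepository A (@no_conflict_one_unknown_one_root P)) :
  exists r : repository P,
    no_conflict_one_unknown_one_root r /\
    exists m : nat, makes_queries A r m /\ n <= m.
Proof.
pose r0 := hard_repo (leq0n #|P|); exists r0; split; first exact: hard_class.
have [h [X [run0 [X_succ _]]]] := A_solves _ (hard_class (leq0n #|P|)).
have X0 : X = set0.
  by move: X_succ; rewrite hard_successfulE // segment0 orbb => /eqP.
exists (size h); split; first by exists h, X.
(* These [n] segments are pairwise distinct, so [h] has at least [n] entries. *)
suff queried k : k < #|P| -> segment P k.+1 \in map fst h.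
  rewrite -card_P -(size_map fst h) -(size_iota 0 #|P|).
  rewrite -(size_map (fun k => segment P k.+1)); apply: uniq_leq_size.
    rewrite map_inj_in_uniq ?iota_uniq // => j k.
    by rewrite !mem_iota; apply: segmentS_inj.
  by move=> _ /mapP[k + ->]; rewrite mem_iota; apply: queried.
move=> ltk; apply/idPn => unqueried.
(* Here [ltk] reads as [k.+1 <= #|P|], so this is the repository for [k.+1]. *)
have [h' [X' [runk [_ X'_max]]]] := A_solves _ (hard_class ltk).
(* Both repositories have the same [known], hence the same strategy, and their oracles differ only
   on the unqueried segment. *)
have run0k : run A (hard_repo ltk) h X.
  apply: (eq_exec run0) => I Ih; rewrite !hard_successfulE // segment0 orbb.
  by case: (I =P segment P k.+1) Ih unqueried => [-> ->|]; rewrite ?orbF.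
have := X'_max (segment P k.+1).
rewrite hard_successfulE // eqxx orbT -(exec_output_inj run0k runk) X0 cards0.
by rewrite leqn0 cards_eq0 (negPf (segmentS_neq0 ltk)) => /(_ isT).
Qed.
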